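(* Let $L = l_1 \lor \dots \lor l_n$ and $M = m_1 \lor \dots \lor m_k$ be first-order clauses. Then $M$ and $L$ are, respectively, the main and side premise of an instance of the subsumption resolution rule (SR) if and only if there exists a substitution $\sigma$ satisfying all four of the following properties: (existence) $\exists i\, j.\ \sigma(l_i) = \neg m_j$; (uniqueness) $\exists j'.\ \forall i\, j.\ \bigl(\sigma(l_i) = \neg m_j \Rightarrow j = j'\bigr)$; (completeness) $\forall i.\ \exists j.\ \bigl(\sigma(l_i) = \neg m_j \lor \sigma(l_i) = m_j\bigr)$; (coherence) $\forall j.\ \bigl( (\exists i.\ \sigma(l_i) = m_j) \Rightarrow \forall i.\ \sigma(l_i) \neq \neg m_j \bigr)$. Here the indices $i$ range over $\{1,\dots,n\}$ and $j, j'$ range over $\{1,\dots,k\}$.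
   Context: Work in first-order logic with equality. A literal is an atom or a negated atom; $\neg m$ denotes the complementary literal of $m$ (with $\neg\neg a = a$). A clause $l_1 \lor \dots \lor l_n$ is a disjunction of literals, also viewed as the (multi)set of its literals; free variables are implicitly universally quantified. A substitution $\sigma$ is a (partial) mapping from variables to terms; $\sigma(E)$ is obtained by simultaneously replacing each variable $x$ in the expression $E$ by $\sigma(x)$, and for a set of literals $S$, $\sigma(S) = \{\sigma(s) : s \in S\}$. Subsumption resolution (SR): clauses $M$ and $L$ are the main and side premise of subsumption resolution iff there exist a substitution $\sigma$, a set of literals $L' \subseteq L$ and a literal $m' \in M$ such that $\sigma(L') = \{\neg m'\}$ and $\sigma(L \setminus L') \subseteq M \setminus \{m'\}$; in that case $M$ may be replaced by $M \setminus \{m'\}$ (the literal $m'$ is called the resolution literal).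
   Formalization: The direction from SR to the four properties is stated only for M with pairwise distinct literals and no complementary pair; it fails otherwise, e.g. M = p ∨ q ∨ ¬q, L = ¬p ∨ q, or M = p ∨ p, L = ¬p. The converse is unrestricted. *)

(* Defs.v *)
From HB Require Import structures.
From mathcomp Require Import all_boot.
From mathcomp Require Import classical_sets.

Set Implicit Arguments.
Unset Strict Implicit.
Unset Printing Implicit Defensive.

Local Open Scope classical_set_scope.

Record signature := Signature {
  fsym : Type;
  farity : fsym -> nat;
  psym : Type;
  parity : psym -> nat }.

Inductive term (S : signature) : Type :=
| Var of nat
| App (f : fsym S) of {ffun 'I_(farity f) -> term S}.

(* Equality is a primitive atom former; atoms and literals are compared
   syntactically, so [Eq s t] and [Eq t s] are different atoms. *)
Inductive atom (S : signature) : Type :=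
| Pred (p : psym S) of {ffun 'I_(parity p) -> term S}
| Eq of term S & term S.

Inductive literal (S : signature) : Type :=
| Pos of atom S
| Neg of atom S.

Arguments Var {S}.

Definition compl (S : signature) (l : literal S) : literal S :=
  match l with
  | Pos a => Neg a
  | Neg a => Pos a
  end.

(* A partial map; [None] means that the variable is left unchanged. *)
Definition substitution (S : signature) := nat -> option (term S).

Fixpoint tsubst (S : signature) (sigma : substitution S) (t : term S) :
    term S :=
  match t with
  | Var x => odflt (Var x) (sigma x)
  | App f a => App [ffun i => tsubst sigma (a i)]
  end.

Definition asubst (S : signature) (sigma : substitution S) (a : atom S) :
    atom S :=
  match a with
  | Pred p ts => Pred [ffun i => tsubst sigma (ts i)]
  | Eq s t => Eq (tsubst sigma s) (tsubst sigma t)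
  end.

Definition lsubst (S : signature) (sigma : substitution S) (l : literal S) :
    literal S :=
  match l with
  | Pos a => Pos (asubst sigma a)
  | Neg a => Neg (asubst sigma a)
  end.

(* [clause S n] is the disjunction [l_1 \/ ... \/ l_n] with its indexing;
   repetitions are allowed, and [lits] is the underlying set of literals. *)
Definition clause (S : signature) (n : nat) := 'I_n -> literal S.

Definition lits (S : signature) (n : nat) (C : clause S n) :
    set (literal S) := range C.

Definition subsumption_resolution (S : signature) (M L : set (literal S)) :
    Prop :=
  exists (sigma : substitution S) (L' : set (literal S)) (m' : literal S),
    [/\ L' `<=` L,
        M m',
        lsubst sigma @` L' = [set compl m'] &
        lsubst sigma @` (L `\` L') `<=` M `\ m'].

Definition complementary_pair (S : signature) (C : set (literal S)) : Prop :=
  exists2 l, C l & C (compl l).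

Definition existence (S : signature) (n k : nat)
    (l : clause S n) (m : clause S k) (sigma : substitution S) : Prop :=
  exists i j, lsubst sigma (l i) = compl (m j).

Definition uniqueness (S : signature) (n k : nat)
    (l : clause S n) (m : clause S k) (sigma : substitution S) : Prop :=
  exists j', forall i j, lsubst sigma (l i) = compl (m j) -> j = j'.

Definition completeness (S : signature) (n k : nat)
    (l : clause S n) (m : clause S k) (sigma : substitution S) : Prop :=
  forall i, exists j,
    lsubst sigma (l i) = compl (m j) \/ lsubst sigma (l i) = m j.

Definition coherence (S : signature) (n k : nat)
    (l : clause S n) (m : clause S k) (sigma : substitution S) : Prop :=
  forall j, (exists i, lsubst sigma (l i) = m j) ->
    forall i, lsubst sigma (l i) <> compl (m j).

Definition sr_constraints (S : signature) (n k : nat)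
    (l : clause S n) (m : clause S k) (sigma : substitution S) : Prop :=
  [/\ existence l m sigma,
      uniqueness l m sigma,
      completeness l m sigma &
      coherence l m sigma].

(* Main.v *)
Require Import Defs.
From mathcomp Require Import all_boot.
From mathcomp Require Import boolp classical_sets.

Local Open Scope classical_set_scope.

(** The same substitution serves both sides. An SR instance says that every literal of L is sent
    either to the complement of one fixed m' or into M without m', the first case occurring at least
    once. Existence and uniqueness single out m', completeness gives this dichotomy, and coherence
    keeps m' itself out of the image. *)

Lemma complK (S : signature) : involutive (@compl S).
Proof. by case. Qed.

Lemma compl_neq (S : signature) (l : literal S) : compl l <> l.
Proof. by case: l. Qed.

(* Take for [L'] all the literals of [L] that sigma maps to the complement of
   the resolution literal. *)
Lemma sr_constraints_subsumption_resolution (S : signature) (n k : nat)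
    (l : clause S n) (m : clause S k) (sigma : substitution S) :
  sr_constraints l m sigma -> subsumption_resolution (lits m) (lits l).
Proof.
move=> [[i0 [j0 e0]] [j' uniq_j'] complete coherent].
exists sigma, [set x | lits l x /\ lsubst sigma x = compl (m j0)], (m j0).
split.
- by move=> x [].
- by exists j0.
- apply/seteqP; split=> [_ [x [_ ex] <-] //|_ ->].
  by exists (l i0) => //; split=> //; exists i0.
- move=> _ [_ [[i _ <-] nL'] <-].
  have [j [ei|ei]] := complete i.
    case: nL'; split; first by exists i.
    (* Both [j] and [j0] equal [j']. *)
    by rewrite ei (uniq_j' _ _ ei) (uniq_j' _ _ e0).
  split; first by exists j.
  by move=> ei0; apply: (coherent j0) e0; exists i.
Qed.

(** The constraints speak of indices, SR of literals: injectivity makes the index of the resolution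
    literal unique, and without complementary pairs a literal sent into M is never the complement of
    some [m j]. *)
Lemma subsumption_resolution_sr_constraints (S : signature) (n k : nat)
    (l : clause S n) (m : clause S k) :
  injective m -> ~ complementary_pair (lits m) ->
  subsumption_resolution (lits m) (lits l) ->
  exists sigma : substitution S, sr_constraints l m sigma.
Proof.
move=> m_inj no_pair [sigma [L' [m' [L'l [j0 _ <-] imL' imD]]]].
have dich i : lsubst sigma (l i) = compl (m j0) \/
    (lits m `\ m j0) (lsubst sigma (l i)).
  have [L'i|nL'i] := pselect (L' (l i)); [left|right].
    have : (lsubst sigma @` L') (lsubst sigma (l i)) by exists (l i).
    by rewrite imL'.
  by apply: imD; exists (l i) => //; split=> //; exists i.
have only_j0 i j : lsubst sigma (l i) = compl (m j) -> j = j0.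
  move=> ei; have [|[mi _]] := dich i.
    by rewrite ei => /(can_inj (@complK S)) /m_inj.
  by case: no_pair; exists (m j); [exists j | rewrite -ei].
exists sigma; split.
- have : [set compl (m j0)] (compl (m j0)) by [].
  by rewrite -imL' => -[x /L'l [i _ <-] ei]; exists i, j0.
- by exists j0.
- move=> i; have [ei|[[j _ ej] _]] := dich i; first by exists j0; left.
  by exists j; right.
(* An image equal to [m j0] fits neither case of [dich]. *)
- move=> j [i ei] i' /only_j0 ej; rewrite ej in ei.
  have [|[_]] := dich i; rewrite ei; last exact.
  by move/esym/compl_neq.
Qed.

(* The hypotheses on m are only needed from left to right: that implication
   fails for clauses m with a repeated literal or a complementary pair. *)
Theorem theorem1 (S : signature) (n k : nat)
    (l : clause S n) (m : clause S k) :
  ((exists sigma : substitution S, sr_constraints l m sigma) ->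
    subsumption_resolution (lits m) (lits l)) /\
  (injective m -> ~ complementary_pair (lits m) ->
    (subsumption_resolution (lits m) (lits l) <->
     exists sigma : substitution S, sr_constraints l m sigma)).
Proof.
have sr_of : (exists sigma, sr_constraints l m sigma) ->
    subsumption_resolution (lits m) (lits l).
  by move=> [sigma]; apply: sr_constraints_subsumption_resolution.
split=> // m_inj no_pair; split=> //.
exact: subsumption_resolution_sr_constraints.
Qed.
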